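(* Let $m(r)=\frac{2}{\pi}(1-r^2)\mathcal{K}(r)\mathcal{K}'(r)$ for $0<r<1$. (i) For a real number $\lambda$, the inequality $$M_{\lambda}(m(x),m(y))\leq m(M_{\lambda}(x,y))$$ holds for all $x,y\in(0,1)$ if and only if $\lambda\leq 0$. (ii) There is a constant $C>0$ such that, for a real number $\lambda$, the reverse inequality $$M_{\lambda}(m(x),m(y))\geq m(M_{\lambda}(x,y))$$ holds for all $x,y\in(0,1)$ if and only if $\lambda\geq C$. (iii) In the inequality of (i) for $\lambda\le 0$, and in the reverse inequality of (ii) for $\lambda\ge C$, equality holds for given $x,y\in(0,1)$ if and only if $x=y$.
   Context: For $0<r<1$ let $r'=\sqrt{1-r^2}$. The complete elliptic integral of the first kind is $\mathcal{K}(r)=\int_0^{\pi/2}\frac{d\theta}{\sqrt{1-r^2\sin^2\theta}}$, and $\mathcal{K}'(r)=\mathcal{K}(r')$ (the prime does not denote a derivative). For $x,y>0$ and real $\lambda$, the power mean is $M_\lambda(x,y)=\left(\frac{x^\lambda+y^\lambda}{2}\right)^{1/\lambda}$ if $\lambda\neq 0$, and $M_0(x,y)=\sqrt{xy}$. *)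

(* Defs.v *)
From Stdlib Require Import Reals.
From Coquelicot Require Import Coquelicot.
Open Scope R_scope.

Definition compl_mod (r : R) : R := sqrt (1 - r ^ 2).

(* For 0 < r < 1 the integrand is continuous on [0, PI/2], so [RInt] is the
   genuine Riemann integral; its value outside that range is irrelevant. *)
Definition ellK (r : R) : R :=
  RInt (fun theta => / sqrt (1 - r ^ 2 * sin theta ^ 2)) 0 (PI / 2).

Definition ellK' (r : R) : R := ellK (compl_mod r).

(* Meaningful for x, y > 0 only, as [Rpower] is. *)
Definition power_mean (lambda x y : R) : R :=
  if Req_EM_T lambda 0 then sqrt (x * y)
  else Rpower ((Rpower x lambda + Rpower y lambda) / 2) (1 / lambda).

Definition m (r : R) : R := 2 / PI * (1 - r ^ 2) * ellK r * ellK' r.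

(* Main.v *)
Require Import Defs.
From Stdlib Require Import Reals Lra Lia List.
From Coquelicot Require Import Coquelicot.
Open Scope R_scope.

(* With [t] the operator [r d/dr], Legendre's relation gives
     q := - t (ln m) = 2 w + n,   w = (1 - E/K) / (1 - r^2),   n = kappa / m,
   and [t w = w^2 + rho], [t n = q n] with [rho = r^2 / (1 - r^2)^2]. The mean inequality
   on an interval is governed by the monotonicity of [(m(r)/r)^lambda q], whose
   logarithm has [t]-derivative [(1 + q) (H - lambda)], where [H = t q / (q (1 + q))].
   The system for [w] and [n] shows [0 < H <= 3] and [inf H = 0], the infimum being
   approached at 0, and [C = sup H]. Strictness at [lambda = C] requires that [H] is
   not equal to [C] on an interval: there [z = q / (1 + q)] would be [c r^C] and
   satisfy a cubic relation with polynomial coefficients in [r]; this relation would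
   extend to all [r > 0] and fails for large [r]. *)

(** * Differentiation under the integral sign for integrands in [1 - k * sin t ^ 2] *)

Lemma delta_bounds (k t : R) : 0 <= k < 1 -> 1 - k <= 1 - k * sin t ^ 2 <= 1.
Proof.
  intros Hk; pose proof (sin2_cos2 t) as Hs.
  pose proof (Rle_0_sqr (cos t)); pose proof (Rle_0_sqr (sin t)); unfold Rsqr in *.
  set (a := sin t) in *; assert (0 <= a * a <= 1) by lra; simpl; rewrite Rmult_1_r; nra.
Qed.

Lemma delta_pos (k t : R) : k < 1 -> 0 < 1 - k * sin t ^ 2.
Proof.
  intros Hk; pose proof (sin2_cos2 t) as Hs.
  pose proof (Rle_0_sqr (cos t)); pose proof (Rle_0_sqr (sin t)); unfold Rsqr in *.
  set (a := sin t) in *; assert (0 <= a * a <= 1) by lra; simpl; rewrite Rmult_1_r.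
  destruct (Rle_lt_dec k 0); nra.
Qed.

Lemma continuous_delta (g : R -> R) (k t : R) :
  k < 1 -> (forall y, 0 < y -> continuous g y) ->
  continuous (fun s => g (1 - k * sin s ^ 2)) t.
Proof.
  intros Hk Hg.
  apply (continuous_comp (fun s => 1 - k * sin s ^ 2) g).
  - apply (ex_derive_continuous (fun s => 1 - k * sin s ^ 2)); auto_derive; auto.
  - now apply Hg, delta_pos.
Qed.

(** One Leibniz rule serves both elliptic integrals, with [g] the square root or its inverse;
    [k < 1] is an open condition that keeps the argument of [g] positive. *)
Lemma is_derive_RInt_delta (g dg : R -> R) (k : R) :
  (forall y, 0 < y -> is_derive g y (dg y)) ->
  (forall y, 0 < y -> continuous dg y) ->
  k < 1 ->
  is_derive (fun k => RInt (fun t => g (1 - k * sin t ^ 2)) 0 (PI / 2)) k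
    (RInt (fun t => - sin t ^ 2 * dg (1 - k * sin t ^ 2)) 0 (PI / 2)).
Proof.
  intros Hg Hdg Hk.
  assert (Hloc : locally k (fun k => k < 1)) by (apply (open_lt 1); exact Hk).
  assert (Hd : forall k t, k < 1 ->
    is_derive (fun u => g (1 - u * sin t ^ 2)) k (- sin t ^ 2 * dg (1 - k * sin t ^ 2))).
  { intros k' t Hk'.
    apply (is_derive_comp g (fun u => 1 - u * sin t ^ 2)).
    - now apply Hg, delta_pos.
    - auto_derive; [easy | ring]. }
  erewrite RInt_ext.
  - apply (is_derive_RInt_param (fun k t => g (1 - k * sin t ^ 2))).
    + revert Hloc; apply filter_imp; intros k' Hk' t _.
      eexists; now apply Hd.
    + intros t _.
      (* The partial derivative has its closed form only where the parameter is below 1, so joint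
         continuity is shown for the closed form and transferred locally. *)
      apply continuity_2d_pt_ext_loc with
        (f := fun u v => - sin v ^ 2 * dg (1 - u * sin v ^ 2)).
      { apply locally_2d_locally.
        apply (filter_imp (fun z => fst z < 1)).
        - intros z Hz; symmetry; apply is_derive_unique; now apply Hd.
        - exact (continuous_fst k t (fun k => k < 1) Hloc). }
      assert (Hsin : continuity_2d_pt (fun u v => sin v ^ 2) k t).
      { apply (continuity_1d_2d_pt_comp (fun v => sin v ^ 2) (fun u v => v)).
        - apply continuity_pt_filterlim, (ex_derive_continuous (fun v => sin v ^ 2)).
          auto_derive; auto.
        - apply continuity_2d_pt_id2. }
      apply continuity_2d_pt_mult.
      * now apply continuity_2d_pt_opp.
      * apply (continuity_1d_2d_pt_comp dg (fun u v => 1 - u * sin v ^ 2)).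
        -- now apply continuity_pt_filterlim, Hdg, delta_pos.
        -- apply continuity_2d_pt_minus; [apply continuity_2d_pt_const |].
           apply continuity_2d_pt_mult; [apply continuity_2d_pt_id1 | exact Hsin].
    + revert Hloc; apply filter_imp; intros k' Hk'.
      apply (ex_RInt_continuous (V := R_CompleteNormedModule)); intros t _.
      apply continuous_delta; auto.
      intros y Hy; apply (ex_derive_continuous g); eexists; now apply Hg.
  - intros t _; symmetry; apply is_derive_unique; now apply Hd.
Qed.

(** * Complete elliptic integrals: derivatives and bounds *)

(* As functions of the parameter [k = r ^ 2]. *)
Definition Kint (k : R) : R := RInt (fun t => / sqrt (1 - k * sin t ^ 2)) 0 (PI / 2).
Definition Eint (k : R) : R := RInt (fun t => sqrt (1 - k * sin t ^ 2)) 0 (PI / 2).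

Lemma continuous_sqrt_pos (y : R) : 0 < y -> continuous sqrt y.
Proof. intros Hy; apply (ex_derive_continuous sqrt); auto_derive; auto. Qed.

Lemma continuous_inv_sqrt (y : R) : 0 < y -> continuous (fun y => / sqrt y) y.
Proof.
  intros Hy; apply (ex_derive_continuous (fun y => / sqrt y)); auto_derive.
  pose proof (sqrt_lt_R0 y Hy); repeat split; auto; lra.
Qed.

Lemma is_RInt_Kint (k : R) :
  k < 1 -> is_RInt (fun t => / sqrt (1 - k * sin t ^ 2)) 0 (PI / 2) (Kint k).
Proof.
  intros Hk; apply (RInt_correct (V := R_CompleteNormedModule)).
  apply (ex_RInt_continuous (V := R_CompleteNormedModule)); intros t _.
  apply (continuous_delta (fun y => / sqrt y)); auto using continuous_inv_sqrt.
Qed.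

Lemma is_RInt_Eint (k : R) :
  k < 1 -> is_RInt (fun t => sqrt (1 - k * sin t ^ 2)) 0 (PI / 2) (Eint k).
Proof.
  intros Hk; apply (RInt_correct (V := R_CompleteNormedModule)).
  apply (ex_RInt_continuous (V := R_CompleteNormedModule)); intros t _.
  apply (continuous_delta sqrt); auto using continuous_sqrt_pos.
Qed.

(** With [D = sqrt (1 - k sin^2 t)] one has [k sin^2 t = 1 - D^2], so the differentiated integrand
    [- sin^2 t / (2 D)] equals [(D - 1 / D) / (2 k)]. *)
Lemma is_derive_Eint (k : R) :
  0 < k < 1 -> is_derive Eint k ((Eint k - Kint k) / (2 * k)).
Proof.
  intros Hk.
  evar_last.
  { apply (is_derive_RInt_delta sqrt (fun y => / (2 * sqrt y))); [| | lra].
    - intros y Hy; auto_derive; [easy | ring].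
    - intros y Hy; apply (ex_derive_continuous (fun y => / (2 * sqrt y))); auto_derive.
      pose proof (sqrt_lt_R0 y Hy); repeat split; auto; lra. }
  apply is_RInt_unique.
  apply (is_RInt_ext (fun t => scal (/ (2 * k))
    (minus (sqrt (1 - k * sin t ^ 2)) (/ sqrt (1 - k * sin t ^ 2))))).
  - intros t _; unfold scal, minus, plus, opp; simpl; unfold mult; simpl.
    pose proof (delta_pos k t (proj2 Hk)) as Hp.
    pose proof (sqrt_lt_R0 _ Hp) as Hq; pose proof (sqrt_sqrt _ (Rlt_le _ _ Hp)) as Hs.
    simpl in *; set (q := sqrt _) in *.
    apply (Rmult_eq_reg_r (2 * k * q)); [| nra].
    replace (/ (2 * k) * (q + - / q) * (2 * k * q)) with (q * q - 1) by (field; lra).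
    replace (- (sin t * (sin t * 1)) * / (2 * q) * (2 * k * q)) with (- k * sin t * sin t)
      by (field; lra).
    lra.
  - replace ((Eint k - Kint k) / (2 * k)) with
      (scal (/ (2 * k)) (minus (Eint k) (Kint k)))
      by (unfold scal, minus, plus, opp; simpl; unfold mult; simpl; field; lra).
    apply (is_RInt_scal (V := R_NormedModule)), (is_RInt_minus (V := R_NormedModule)).
    + now apply is_RInt_Eint.
    + now apply is_RInt_Kint.
Qed.

Lemma is_derive_Kint (k : R) :
  0 < k < 1 -> is_derive Kint k ((Eint k - (1 - k) * Kint k) / (2 * k * (1 - k))).
Proof.
  intros Hk.
  evar_last.
  { apply (is_derive_RInt_delta (fun y => / sqrt y) (fun y => - / (2 * y * sqrt y))); [| | lra].
    - intros y Hy; pose proof (sqrt_lt_R0 y Hy).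
      auto_derive; [repeat split; auto; lra |].
      rewrite <- (sqrt_sqrt y) at 4 by lra; field; lra.
    - intros y Hy; pose proof (sqrt_lt_R0 y Hy).
      apply (ex_derive_continuous (fun y => - / (2 * y * sqrt y))); auto_derive.
      repeat split; auto; apply Rgt_not_eq; nra. }
  apply is_RInt_unique.
  (* Up to the factor [1 / (2 * (1 - k))], the integrands differ by the derivative of
     [sin t * cos t / sqrt (1 - k * sin t ^ 2)], which vanishes at both ends. *)
  set (P := fun t => sin t * cos t / sqrt (1 - k * sin t ^ 2)).
  set (dP := fun t => (1 - 2 * sin t ^ 2 + k * sin t ^ 4)
    / ((1 - k * sin t ^ 2) * sqrt (1 - k * sin t ^ 2))).
  assert (HP : is_RInt dP 0 (PI / 2) (minus (P (PI / 2)) (P 0))).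
  { apply (is_RInt_derive (V := R_CompleteNormedModule) P dP).
    - intros t _; unfold P, dP.
      pose proof (delta_pos k t (proj2 Hk)) as Hp.
      pose proof (sqrt_lt_R0 _ Hp) as Hq; pose proof (sqrt_sqrt _ (Rlt_le _ _ Hp)) as Hs.
      auto_derive; simpl in *; unfold Rminus in *.
      + repeat split; auto; lra.
      + set (q := sqrt _) in *; rewrite <- Hs.
        pose proof (sin2_cos2 t) as Hsc; unfold Rsqr in Hsc.
        set (s := sin t) in *; set (c := cos t) in *.
        apply (Rmult_eq_reg_r (q * q * q)); [| apply Rgt_not_eq; repeat apply Rmult_lt_0_compat; lra].
        transitivity ((c * c - s * s) * (q * q) + s * s * k * (c * c)).
        * field; lra.
        * replace (c * c) with (1 - s * s) by lra; rewrite Hs; field_simplify; [ring | lra].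
    - intros t _; unfold dP.
      apply (ex_derive_continuous (fun t => (1 - 2 * sin t ^ 2 + k * sin t ^ 4)
        / ((1 - k * sin t ^ 2) * sqrt (1 - k * sin t ^ 2)))).
      pose proof (delta_pos k t (proj2 Hk)) as Hp.
      pose proof (sqrt_lt_R0 _ Hp) as Hq.
      auto_derive; repeat split; auto; simpl in *; unfold Rminus in *; apply Rgt_not_eq; nra. }
  apply (is_RInt_ext (fun t => minus (scal (/ (2 * k * (1 - k)))
    (minus (sqrt (1 - k * sin t ^ 2)) (scal (1 - k) (/ sqrt (1 - k * sin t ^ 2)))))
      (scal (/ (2 * (1 - k))) (dP t)))).
  - intros t _; unfold scal, minus, plus, opp; simpl; unfold mult; simpl; unfold dP.
    pose proof (delta_pos k t (proj2 Hk)) as Hp.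
    pose proof (sqrt_lt_R0 _ Hp) as Hq; pose proof (sqrt_sqrt _ (Rlt_le _ _ Hp)) as Hs.
    simpl in *; set (q := sqrt _) in *; rewrite <- Hs.
    apply (Rmult_eq_reg_r (2 * k * (1 - k) * (q * q * q)));
      [| apply Rgt_not_eq; repeat apply Rmult_lt_0_compat; lra].
    set (s := sin t) in *.
    transitivity ((q * q) * (q * q) - (1 - k) * (q * q) - k * (1 - 2 * s ^ 2 + k * s ^ 4)).
    + field; lra.
    + transitivity (k * (1 - k) * (s * s)); [rewrite Hs; ring | field; lra].
  - replace ((Eint k - (1 - k) * Kint k) / (2 * k * (1 - k))) with
      (minus (scal (/ (2 * k * (1 - k))) (minus (Eint k) (scal (1 - k) (Kint k))))
         (scal (/ (2 * (1 - k))) (minus (P (PI / 2)) (P 0)))).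
    + apply (is_RInt_minus (V := R_NormedModule));
        apply (is_RInt_scal (V := R_NormedModule)); [| exact HP].
      apply (is_RInt_minus (V := R_NormedModule)); [now apply is_RInt_Eint |].
      apply (is_RInt_scal (V := R_NormedModule)); now apply is_RInt_Kint.
    + unfold scal, minus, plus, opp; simpl; unfold mult; simpl; unfold P.
      rewrite sin_0, cos_PI2; unfold Rdiv; rewrite ?Rmult_0_l, ?Rmult_0_r, ?Rmult_0_l.
      field; lra.
Qed.

Lemma Kint_pos (k : R) : 0 < k < 1 -> 0 < Kint k.
Proof.
  intros Hk; apply RInt_gt_0; [pose proof PI_RGT_0; lra | |].
  - intros t _; apply Rinv_0_lt_compat, sqrt_lt_R0, delta_pos; lra.
  - intros t _; apply (continuous_delta (fun y => / sqrt y)); [lra | apply continuous_inv_sqrt].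
Qed.

Lemma Eint_lt_Kint (k : R) : 0 < k < 1 -> Eint k < Kint k.
Proof.
  intros Hk; pose proof PI_RGT_0; apply RInt_lt; [lra | | |].
  - intros t _; apply (continuous_delta (fun y => / sqrt y)); [lra | apply continuous_inv_sqrt].
  - intros t _; apply (continuous_delta sqrt); [lra | apply continuous_sqrt_pos].
  - intros t Ht.
    pose proof (delta_pos k t (proj2 Hk)) as Hp.
    assert (0 < sin t ^ 2) by (apply pow_lt, sin_gt_0; lra).
    assert (1 - k * sin t ^ 2 < 1) by nra.
    apply (Rmult_lt_reg_r (sqrt (1 - k * sin t ^ 2))); [now apply sqrt_lt_R0 |].
    rewrite sqrt_sqrt by lra; rewrite Rinv_l; [lra |].
    apply Rgt_not_eq; now apply sqrt_lt_R0.
Qed.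

(** Pointwise, [(1 - k sin^2 t) - (1 - k) = k cos^2 t], which is positive inside the interval. *)
Lemma Kint_lt_Eint (k : R) : 0 < k < 1 -> (1 - k) * Kint k < Eint k.
Proof.
  intros Hk; pose proof PI_RGT_0.
  replace ((1 - k) * Kint k) with
    (RInt (fun t => scal (1 - k) (/ sqrt (1 - k * sin t ^ 2))) 0 (PI / 2)).
  2:{ apply is_RInt_unique.
      apply (is_RInt_scal (V := R_NormedModule) _ _ _ (1 - k) (Kint k)); now apply is_RInt_Kint. }
  apply RInt_lt; [lra | | |].
  - intros t _; apply (continuous_delta sqrt); [lra | apply continuous_sqrt_pos].
  - intros t _; apply (continuous_scal_r (V := R_NormedModule)), (continuous_delta (fun y => / sqrt y));
      [lra | apply continuous_inv_sqrt].
  - intros t Ht; unfold scal; simpl; unfold mult; simpl.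
    pose proof (delta_pos k t (proj2 Hk)) as Hp; simpl in Hp.
    assert (0 < cos t) by (apply cos_gt_0; lra).
    pose proof (sin2_cos2 t) as Hsc; unfold Rsqr in Hsc.
    pose proof (sqrt_lt_R0 _ Hp) as Hq.
    apply (Rmult_lt_reg_r (sqrt (1 - k * (sin t * (sin t * 1))))); [assumption |].
    rewrite sqrt_sqrt, Rmult_assoc, Rinv_l by lra.
    assert (0 < k * (cos t * cos t)) by (repeat apply Rmult_lt_0_compat; lra).
    replace (cos t * cos t) with (1 - sin t * sin t) in * by lra; nra.
Qed.

(** The integrand is largest at [t = PI / 2]. This crude bound suffices to keep [r * m r]
    bounded. *)
Lemma Kint_le (k : R) : 0 < k < 1 -> Kint k <= PI / 2 / sqrt (1 - k).
Proof.
  intros Hk.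
  replace (PI / 2 / sqrt (1 - k)) with (RInt (fun _ => / sqrt (1 - k)) 0 (PI / 2)).
  2:{ rewrite RInt_const; unfold scal; simpl; unfold mult; simpl; unfold Rdiv; ring. }
  apply RInt_le; [pose proof PI_RGT_0; lra | | |].
  - eexists; now apply is_RInt_Kint.
  - apply ex_RInt_const.
  - intros t _; apply Rinv_le_contravar; [apply sqrt_lt_R0; lra |].
    apply sqrt_le_1_alt; apply delta_bounds; lra.
Qed.

(** * Legendre's relation *)

Lemma eq_of_derive_zero (f : R -> R) (a b : R) :
  (forall x, a < x < b -> is_derive f x 0) ->
  forall x y, a < x < b -> a < y < b -> f x = f y.
Proof.
  intros Hf x y Hx Hy.
  assert (Hin : forall c, Rmin y x <= c <= Rmax y x -> a < c < b).
  { intros c; unfold Rmin, Rmax; destruct (Rle_dec y x); lra. }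
  destruct (MVT_gen f y x (fun _ => 0)) as (c & _ & Hc).
  - intros c Hc; apply Hf, Hin; lra.
  - intros c Hc; apply continuity_pt_filterlim, (ex_derive_continuous f).
    eexists; now apply Hf, Hin.
  - lra.
Qed.

Definition legendre (k : R) : R :=
  Eint k * Kint (1 - k) + Eint (1 - k) * Kint k - Kint k * Kint (1 - k).

(** Inserting the derivatives of the four integrals makes the derivative of [legendre] cancel
    identically. *)
Lemma legendre_const (k : R) : 0 < k < 1 -> legendre k = legendre (1 / 2).
Proof.
  intros Hk; apply (eq_of_derive_zero legendre 0 1); [| lra | lra].
  intros x Hx; unfold legendre.
  assert (HK := is_derive_Kint x Hx); assert (HE := is_derive_Eint x Hx).
  assert (HK' := is_derive_Kint (1 - x) ltac:(lra)).
  assert (HE' := is_derive_Eint (1 - x) ltac:(lra)).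
  auto_derive.
  - repeat split; eexists; eassumption.
  - assert (DK : Derive (fun x : R => Kint x) x = _) by (apply is_derive_unique, HK).
    assert (DE : Derive (fun x : R => Eint x) x = _) by (apply is_derive_unique, HE).
    assert (DK' : Derive (fun x : R => Kint x) (1 - x) = _) by (apply is_derive_unique, HK').
    assert (DE' : Derive (fun x : R => Eint x) (1 - x) = _) by (apply is_derive_unique, HE').
    unfold Rminus in *; rewrite DK, DE, DK', DE'.
    field; lra.
Qed.

(** Legendre's relation gives this number the value 1; the proof treats it as a positive
    constant. *)
Definition kappa : R := 2 * legendre (1 / 2) / PI.

(** At [k = 1 / 2] both parameters coincide and [legendre] is [K (2 E - K)], where [E > K / 2]. *)
Lemma kappa_pos : 0 < kappa.
Proof.
  pose proof PI_RGT_0.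
  apply Rdiv_lt_0_compat; [| assumption].
  unfold legendre; replace (1 - 1 / 2) with (1 / 2) by lra.
  pose proof (Kint_lt_Eint (1 / 2) ltac:(lra)); pose proof (Kint_pos (1 / 2) ltac:(lra)); nra.
Qed.

(** * The function [m] and the differential system for [w], [n] and [q] *)

Lemma m_Kint (r : R) :
  0 < r < 1 -> m r = 2 / PI * (1 - r ^ 2) * Kint (r ^ 2) * Kint (1 - r ^ 2).
Proof.
  intros Hr; unfold m, ellK', ellK, compl_mod.
  rewrite pow2_sqrt by nra; reflexivity.
Qed.

Lemma pow2_unit (r : R) : 0 < r < 1 -> 0 < r ^ 2 < 1.
Proof. intros; split; nra. Qed.

Lemma m_pos (r : R) : 0 < r < 1 -> 0 < m r.
Proof.
  intros Hr; pose proof (pow2_unit r Hr); pose proof PI_RGT_0; rewrite m_Kint by assumption.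
  repeat apply Rmult_lt_0_compat; try apply Kint_pos; try lra.
  apply Rinv_0_lt_compat; lra.
Qed.

(** With [s = sqrt (1 - r^2)], [r * m r] is [2 / PI] times [s], [s K] and [r K'], where [s <= 1] and
    the last two factors are at most [PI / 2]. *)
Lemma m_le (r : R) : 0 < r < 1 -> r * m r <= PI / 2.
Proof.
  intros Hr; pose proof (pow2_unit r Hr) as Hk; pose proof PI_RGT_0.
  rewrite m_Kint by assumption.
  pose proof (Kint_le (r ^ 2) Hk) as H1.
  pose proof (Kint_le (1 - r ^ 2) ltac:(lra)) as H2.
  replace (1 - (1 - r ^ 2)) with (r ^ 2) in H2 by ring.
  rewrite sqrt_pow2 in H2 by lra.
  pose proof (Kint_pos (r ^ 2) Hk); pose proof (Kint_pos (1 - r ^ 2) ltac:(lra)).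
  set (s := sqrt (1 - r ^ 2)) in *.
  assert (Hs : 0 < s) by (apply sqrt_lt_R0; lra).
  assert (Hss : s * s = 1 - r ^ 2) by (apply sqrt_sqrt; lra).
  assert (s <= 1) by nra.
  apply (Rmult_le_compat_l s) in H1; [| lra].
  replace (s * (PI / 2 / s)) with (PI / 2) in H1 by (field; lra).
  apply (Rmult_le_compat_l r) in H2; [| lra].
  replace (r * (PI / 2 / r)) with (PI / 2) in H2 by (field; lra).
  set (K := Kint (r ^ 2)) in *; set (K' := Kint (1 - r ^ 2)) in *.
  replace (r * (2 / PI * (1 - r ^ 2) * K * K'))
    with (2 / PI * (s * ((s * K) * (r * K')))) by (rewrite <- Hss; ring).
  apply Rle_trans with (2 / PI * (PI / 2 * (PI / 2))); [| right; field; lra].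
  apply Rmult_le_compat_l; [apply Rlt_le, Rdiv_lt_0_compat; lra |].
  apply Rle_trans with (1 * ((s * K) * (r * K'))).
  - apply Rmult_le_compat_r; [| assumption].
    repeat apply Rmult_le_pos; lra.
  - rewrite Rmult_1_l; apply Rmult_le_compat; try apply Rmult_le_pos; lra.
Qed.

Definition wfun (r : R) : R := (1 - Eint (r ^ 2) / Kint (r ^ 2)) / (1 - r ^ 2).
Definition rho (r : R) : R := r ^ 2 / (1 - r ^ 2) ^ 2.
Definition nfun (r : R) : R := kappa / m r.
(* [qfun r] is the negated logarithmic derivative [- r * m' r / m r]; the form
   below comes from Legendre's relation. *)
Definition qfun (r : R) : R := 2 * wfun r + nfun r.

Lemma rho_pos (r : R) : 0 < r < 1 -> 0 < rho r.
Proof.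
  intros Hr; pose proof (pow2_unit r Hr); apply Rdiv_lt_0_compat; [| apply pow_lt]; lra.
Qed.

Lemma nfun_pos (r : R) : 0 < r < 1 -> 0 < nfun r.
Proof. intros Hr; apply Rdiv_lt_0_compat; [apply kappa_pos | now apply m_pos]. Qed.

Lemma wfun_bounds (r : R) : 0 < r < 1 -> 0 < wfun r < r ^ 2 / (1 - r ^ 2).
Proof.
  intros Hr; pose proof (pow2_unit r Hr) as Hk; unfold wfun.
  pose proof (Kint_pos _ Hk) as HK.
  pose proof (Eint_lt_Kint _ Hk); pose proof (Kint_lt_Eint _ Hk).
  set (E := Eint _) in *; set (K := Kint _) in *.
  assert (E / K < 1) by (apply Rlt_div_l; lra).
  assert (1 - r ^ 2 < E / K) by (apply Rlt_div_r; lra).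
  split; [apply Rdiv_lt_0_compat; lra |].
  apply Rmult_lt_compat_r; [apply Rinv_0_lt_compat |]; lra.
Qed.

Lemma qfun_pos (r : R) : 0 < r < 1 -> 0 < qfun r.
Proof.
  intros Hr; unfold qfun; pose proof (nfun_pos r Hr); pose proof (wfun_bounds r Hr); lra.
Qed.

(** The logarithmic derivative contains [E / K] and [E' / K']; Legendre's relation eliminates the
    latter at the cost of a constant multiple of [1 / (K K')], which becomes [n]. *)
Lemma is_derive_m (r : R) : 0 < r < 1 -> is_derive m r (- qfun r * m r / r).
Proof.
  intros Hr.
  apply (is_derive_ext_loc
    (fun r => 2 / PI * (1 - r ^ 2) * Kint (r ^ 2) * Kint (1 - r ^ 2))).
  { apply (filter_imp (fun r => 0 < r /\ r < 1)).
    - intros x Hx; symmetry; now apply m_Kint.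
    - apply filter_and; [apply (open_gt 0) | apply (open_lt 1)]; apply Hr. }
  pose proof (pow2_unit r Hr) as Hk; pose proof PI_RGT_0.
  assert (HK := is_derive_Kint _ Hk).
  assert (HK' := is_derive_Kint (1 - r ^ 2) ltac:(lra)).
  pose proof (Kint_pos _ Hk); pose proof (Kint_pos (1 - r ^ 2) ltac:(lra)).
  pose proof (legendre_const _ Hk) as HL.
  evar_last.
  - apply (is_derive_mult (fun r => 2 / PI * (1 - r ^ 2) * Kint (r ^ 2)) (fun r => Kint (1 - r ^ 2)));
      [| | exact Rmult_comm].
    + apply (is_derive_mult (fun r => 2 / PI * (1 - r ^ 2)) (fun r => Kint (r ^ 2)));
        [| | exact Rmult_comm].
      * apply (is_derive_scal (fun r => 1 - r ^ 2) r (2 / PI) (- 2 * r)).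
        auto_derive; [easy | ring].
      * apply (is_derive_comp Kint (fun r => r ^ 2) r _ (2 * r) HK).
        auto_derive; [easy | ring].
    + apply (is_derive_comp Kint (fun r => 1 - r ^ 2) r _ (- 2 * r) HK').
      auto_derive; [easy | ring].
  - unfold qfun, wfun, nfun, kappa.
    (* Rewriting the constant inside [kappa] as [legendre (r ^ 2)] turns the claim into a rational
       identity. *)
    rewrite m_Kint, <- HL by assumption; unfold legendre.
    unfold plus, scal; simpl; unfold mult; simpl in *; rewrite !Rmult_1_r in *.
    field; repeat split; lra.
Qed.

(** The derivatives of [E] and [K] are linear in [E] and [K], so their quotient satisfies a Riccati
    equation; the normalization of [w] removes its linear term. *)
Lemma is_derive_wfun (r : R) :
  0 < r < 1 -> is_derive wfun r ((wfun r ^ 2 + rho r) / r).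
Proof.
  intros Hr; pose proof (pow2_unit r Hr) as Hk.
  assert (HK := is_derive_Kint _ Hk); assert (HE := is_derive_Eint _ Hk).
  pose proof (Kint_pos _ Hk).
  unfold wfun, rho.
  evar_last.
  - apply (is_derive_div (fun r => 1 - Eint (r ^ 2) / Kint (r ^ 2)) (fun r => 1 - r ^ 2) r
      (- ((2 * r * ((Eint (r ^ 2) - Kint (r ^ 2)) / (2 * r ^ 2)) * Kint (r ^ 2)
       - Eint (r ^ 2) * (2 * r * ((Eint (r ^ 2) - (1 - r ^ 2) * Kint (r ^ 2)) / (2 * r ^ 2 * (1 - r ^ 2)))))
         / Kint (r ^ 2) ^ 2)) (- 2 * r)).
    + rewrite <- (Rplus_0_l (- _)).
      apply (is_derive_minus (fun _ => 1) (fun r => Eint (r ^ 2) / Kint (r ^ 2))); [apply (is_derive_const 1 r) |].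
      apply (is_derive_div (fun r => Eint (r ^ 2)) (fun r => Kint (r ^ 2))); [| | lra].
      * apply (is_derive_comp Eint (fun r => r ^ 2) r _ (2 * r) HE).
        auto_derive; [easy | ring].
      * apply (is_derive_comp Kint (fun r => r ^ 2) r _ (2 * r) HK).
        auto_derive; [easy | ring].
    + auto_derive; [easy | ring].
    + lra.
  - field; repeat split; nra.
Qed.

Lemma is_derive_nfun (r : R) : 0 < r < 1 -> is_derive nfun r (qfun r * nfun r / r).
Proof.
  intros Hr; pose proof (m_pos r Hr).
  unfold nfun at 1; evar_last.
  - apply (is_derive_div (fun _ => kappa) m); [apply (is_derive_const kappa r) | now apply is_derive_m | lra].
  - unfold nfun, zero; simpl; field; lra.
Qed.

Definition dqfun (r : R) : R := 2 * (wfun r ^ 2 + rho r) + qfun r * nfun r.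

Lemma is_derive_qfun (r : R) : 0 < r < 1 -> is_derive qfun r (dqfun r / r).
Proof.
  intros Hr; unfold qfun at 1; evar_last.
  - apply (is_derive_plus (fun r => 2 * wfun r) nfun).
    + apply (is_derive_scal wfun r 2); now apply is_derive_wfun.
    + now apply is_derive_nfun.
  - unfold dqfun, plus; simpl; field; lra.
Qed.

(** Substituting [2 w = q - n] cancels the product [q n]. The result is visibly positive, and it
    determines [n^2] once [t q] is known in terms of [q]. *)
Lemma dqfun_eq (r : R) : dqfun r = (qfun r ^ 2 + nfun r ^ 2) / 2 + 2 * rho r.
Proof. unfold dqfun, qfun; field. Qed.

(** * The function [H]: positivity, continuity and an upper bound *)

Definition Hfun (r : R) : R := dqfun r / (qfun r * (1 + qfun r)).

Lemma Hfun_pos (r : R) : 0 < r < 1 -> 0 < Hfun r.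
Proof.
  intros Hr; pose proof (qfun_pos r Hr); pose proof (rho_pos r Hr).
  apply Rdiv_lt_0_compat; [rewrite dqfun_eq |]; nra.
Qed.

Lemma continuous_Hfun (r : R) : 0 < r < 1 -> continuous Hfun r.
Proof.
  intros Hr; pose proof (qfun_pos r Hr); pose proof (pow2_unit r Hr).
  apply (ex_derive_continuous Hfun); unfold Hfun, dqfun, rho.
  assert (ex_derive wfun r) by (eexists; now apply is_derive_wfun).
  assert (ex_derive nfun r) by (eexists; now apply is_derive_nfun).
  assert (ex_derive qfun r) by (eexists; now apply is_derive_qfun).
  auto_derive; repeat split; auto; simpl in *; apply Rgt_not_eq; nra.
Qed.

Lemma pos_derive_incr (f df : R -> R) (a b : R) :
  a < b -> (forall c, a <= c <= b -> is_derive f c (df c)) ->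
  (forall c, a < c < b -> 0 < df c) -> f a < f b.
Proof.
  intros Hab Hf Hdf.
  destruct (MVT_cor2 f df a b Hab) as (c & Hc & Hcab).
  - intros c Hc; now apply is_derive_Reals, Hf.
  - specialize (Hdf c Hcab); nra.
Qed.

(** The left side [g] satisfies [t g = rho], so [t (w - g) = w^2 > 0], and both functions tend to 0
    at 0. *)
Lemma wfun_lower (r : R) : 0 < r < 1 -> r ^ 2 / (2 * (1 - r ^ 2)) <= wfun r.
Proof.
  intros Hr; apply Rnot_lt_le; intros Hlt.
  (* [w - g] increases, so if equal to [- d < 0] at [r] it stays below [- d] near 0. *)
  set (g := fun r => r ^ 2 / (2 * (1 - r ^ 2))).
  set (d := g r - wfun r).
  assert (Hd : 0 < d) by (unfold d, g; lra).
  (* Here [e <= 1 / 2] gives [g e <= e], and [e <= d] with [w e > 0] then gives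
     [w e - g e > - d]. *)
  set (e := Rmin (r / 2) d).
  assert (He : 0 < e < r /\ e <= d /\ e <= 1 / 2)
    by (unfold e, Rmin; destruct (Rle_dec _ _); lra).
  assert (Hge : g e <= e) by (apply Rle_div_l; nra).
  pose proof (wfun_bounds e ltac:(lra)).
  assert (wfun e - g e < wfun r - g r).
  { apply (pos_derive_incr (fun r => wfun r - g r) (fun r => wfun r ^ 2 / r)); [lra | |].
    - intros c Hc; pose proof (pow2_unit c ltac:(lra)).
      replace (wfun c ^ 2 / c) with ((wfun c ^ 2 + rho c) / c - rho c / c) by (field; lra).
      apply (is_derive_minus wfun g).
      + apply is_derive_wfun; lra.
      + unfold g, rho; auto_derive; [lra | field; lra].
    - intros c Hc; pose proof (wfun_bounds c ltac:(lra)).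
      apply Rdiv_lt_0_compat; nra. }
  unfold d in *; lra.
Qed.

(** The 3 arises as 1 + 2: [2 w^2 + q n <= q^2] because [2 w + n = q], and [rho <= q (1 + q)]
    because [rho = g (1 + g)] with [g = r^2 / (1 - r^2) <= q]. *)
Lemma Hfun_le (r : R) : 0 < r < 1 -> Hfun r <= 3.
Proof.
  intros Hr; pose proof (wfun_lower r Hr); pose proof (pow2_unit r Hr) as Hk.
  pose proof (nfun_pos r Hr); pose proof (wfun_bounds r Hr); pose proof (qfun_pos r Hr).
  unfold Hfun; apply Rle_div_l; [nra |].
  assert (Hrho : rho r <= qfun r * (1 + qfun r)).
  { set (g := r ^ 2 / (1 - r ^ 2)).
    assert (Hg : g <= qfun r).
    { replace g with (2 * (r ^ 2 / (2 * (1 - r ^ 2)))) by (unfold g; field; lra).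
      unfold qfun; lra. }
    assert (0 < g) by (apply Rdiv_lt_0_compat; lra).
    replace (rho r) with (g * (1 + g)) by (unfold rho, g; field; lra).
    apply Rmult_le_compat; lra. }
  unfold dqfun, qfun in *; nra.
Qed.

(** * Exponential sums and their identity theorem *)

(** Exponents may repeat and coefficients may vanish, so that sums and products of lists need no
    normalization. *)
Fixpoint expsum (l : list (R * R)) (s : R) : R :=
  match l with
  | nil => 0
  | ce :: l => fst ce * exp (snd ce * s) + expsum l s
  end.

Definition is_expsum (f : R -> R) : Prop := exists l, forall s, f s = expsum l s.

Lemma expsum_app (l l' : list (R * R)) (s : R) :
  expsum (l ++ l') s = expsum l s + expsum l' s.
Proof. induction l as [| ce l IH]; simpl; [| rewrite IH]; ring. Qed.

Lemma is_expsum_exp (d e : R) : is_expsum (fun s => exp (d + e * s)).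
Proof. exists ((exp d, e) :: nil); intros s; simpl; rewrite exp_plus; ring. Qed.

Lemma is_expsum_const (c : R) : is_expsum (fun _ => c).
Proof. exists ((c, 0) :: nil); intros s; simpl; rewrite Rmult_0_l, exp_0; ring. Qed.

Lemma is_expsum_plus (f g : R -> R) :
  is_expsum f -> is_expsum g -> is_expsum (fun s => f s + g s).
Proof.
  intros [l Hl] [l' Hl']; exists (l ++ l'); intros s.
  now rewrite expsum_app, Hl, Hl'.
Qed.

Lemma is_expsum_mult (f g : R -> R) :
  is_expsum f -> is_expsum g -> is_expsum (fun s => f s * g s).
Proof.
  intros [l Hl] [l' Hl'].
  assert (Hll : is_expsum (fun s => expsum l s * expsum l' s)).
  { clear; induction l as [| [c e] l [k Hk]].
    - exists nil; intros s; simpl; ring.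
    - exists (map (fun ce => (c * fst ce, e + snd ce)) l' ++ k); intros s.
      rewrite expsum_app, <- Hk; simpl.
      replace (expsum (map _ l') s) with (c * exp (e * s) * expsum l' s); [ring |].
      clear; induction l' as [| [c' e'] l' IH]; simpl; [ring |].
      rewrite <- IH, Rmult_plus_distr_r, exp_plus; ring. }
  destruct Hll as [k Hk]; exists k; intros s; now rewrite Hl, Hl', Hk.
Qed.

Lemma is_expsum_minus (f g : R -> R) :
  is_expsum f -> is_expsum g -> is_expsum (fun s => f s - g s).
Proof.
  intros Hf Hg.
  destruct (is_expsum_plus _ _ Hf (is_expsum_mult _ _ (is_expsum_const (- 1)) Hg)) as [l Hl].
  exists l; intros s; rewrite <- Hl; ring.
Qed.

Lemma is_expsum_pow (f : R -> R) (n : nat) :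
  is_expsum f -> is_expsum (fun s => f s ^ n).
Proof.
  intros Hf; induction n as [| n IH]; simpl.
  - apply is_expsum_const.
  - now apply is_expsum_mult.
Qed.

Lemma is_derive_expsum_shift (l : list (R * R)) (e s : R) :
  is_derive (fun s => exp (- e * s) * expsum l s) s
    (expsum (map (fun ce => (fst ce * (snd ce - e), snd ce - e)) l) s).
Proof.
  induction l as [| [c e'] l IH]; simpl.
  - apply (is_derive_ext (fun _ => 0)); [intros t; change (0 = exp (- e * t) * 0); ring | apply (is_derive_const 0 s)].
  - apply (is_derive_ext (fun s => c * exp ((e' - e) * s) + exp (- e * s) * expsum l s)).
    + intros t; replace ((e' - e) * t) with (- e * t + e' * t) by ring.
      rewrite exp_plus; apply Rminus_diag_uniq; ring.
    + apply (is_derive_plus (fun s => c * exp ((e' - e) * s))); [| exact IH].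
      auto_derive; [easy | ring].
Qed.

(* Dividing by one exponential and differentiating removes one term of the sum. *)
Lemma expsum_zero (l : list (R * R)) (a b : R) :
  a < b -> (forall s, a < s < b -> expsum l s = 0) -> forall s, expsum l s = 0.
Proof.
  intros Hab; remember (length l) as n eqn:Hn; revert l Hn.
  induction n as [| n IH]; intros [| [c e] l] Hn Hz s; try discriminate; [reflexivity |].
  set (g := fun s => exp (- e * s) * expsum ((c, e) :: l) s).
  pose (l' := map (fun ce => (fst ce * (snd ce - e), snd ce - e)) l).
  assert (Hg : forall s, is_derive g s (expsum l' s)).
  { intros t; evar_last; [apply is_derive_expsum_shift |].
    apply Rminus_diag_uniq; simpl; unfold l'; ring. }
  assert (Hl' : forall s, expsum l' s = 0).
  { apply IH; [unfold l'; rewrite length_map; simpl in Hn; lia |].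
    intros t Ht; rewrite <- (is_derive_unique _ _ _ (Hg t)).
    apply is_derive_unique, (is_derive_ext_loc (fun _ => 0)).
    - apply (filter_imp (fun u => a < u /\ u < b)).
      + intros u Hu; unfold g; now rewrite Hz, Rmult_0_r.
      + apply filter_and; [apply (open_gt a) | apply (open_lt b)]; apply Ht.
    - apply (is_derive_const 0 t). }
  (* The derivative of [g] now vanishes on the whole line, so [g s] equals the value at the midpoint
     of [a] and [b], which is 0. *)
  assert (Hgs : g s = 0).
  { transitivity (g ((a + b) / 2)).
    - apply (eq_of_derive_zero g (Rmin a s - 1) (Rmax b s + 1)).
      + intros t _; rewrite <- (Hl' t); apply Hg.
      + unfold Rmin, Rmax; destruct (Rle_dec a s), (Rle_dec b s); lra.
      + unfold Rmin, Rmax; destruct (Rle_dec a s), (Rle_dec b s); lra.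
    - unfold g; rewrite Hz by lra; ring. }
  apply Rmult_integral in Hgs; destruct Hgs as [Hgs |]; [| assumption].
  pose proof (exp_pos (- e * s)); lra.
Qed.

Lemma is_expsum_zero (f : R -> R) (a b : R) :
  is_expsum f -> a < b -> (forall s, a < s < b -> f s = 0) -> forall s, f s = 0.
Proof.
  intros [l Hl] Hab Hf s; rewrite Hl; apply (expsum_zero l a b Hab).
  intros t Ht; rewrite <- Hl; auto.
Qed.

(** * [H] is not constant on any interval *)

(* The third-order equation of [m], written for [z = q / (1 + q)] when [H = C]. *)
Definition Hconst_poly (C x z : R) : R :=
  (1 - x ^ 2) ^ 3 * (z ^ 3 + (C ^ 2 - 3 * C) * z ^ 2 + C ^ 2 * z)
  + 4 * x ^ 2 * (1 - x ^ 2) * z * (1 - z) ^ 2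
  - 4 * x ^ 2 * (1 + x ^ 2) * (1 - z) ^ 3.

Lemma is_derive_rho (r : R) :
  0 < r < 1 -> is_derive rho r (2 * r * (1 + r ^ 2) / (1 - r ^ 2) ^ 3).
Proof.
  intros Hr; pose proof (pow2_unit r Hr).
  assert (1 - r * r <> 0) by nra.
  unfold rho; auto_derive.
  - simpl; unfold Rminus in *; rewrite ?Rmult_1_r; now repeat apply Rmult_integral_contrapositive_currified.
  - simpl; field; assumption.
Qed.

(** When [H = C], [dqfun_eq] expresses [n^2] by [q] and [rho]. Differentiating this with [t n = q n]
    and [t q = C q (1 + q)], then substituting for [n^2] again, leaves a relation between [q] and
    [x] alone. *)
Lemma Hfun_const_poly (C a b : R) :
  0 <= a -> b <= 1 -> (forall x, a < x < b -> Hfun x = C) ->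
  forall x, a < x < b -> Hconst_poly C x (qfun x / (1 + qfun x)) = 0.
Proof.
  intros Ha Hb HC x Hx.
  assert (Hdq : forall y, a < y < b -> dqfun y = C * (qfun y * (1 + qfun y))).
  { intros y Hy; pose proof (qfun_pos y ltac:(lra)).
    rewrite <- (HC y Hy); unfold Hfun; field; lra. }
  pose proof (qfun_pos x ltac:(lra)) as Hq.
  pose proof (pow2_unit x ltac:(lra)) as Hk.
  assert (Hn : nfun x ^ 2 = 2 * C * (qfun x * (1 + qfun x)) - qfun x ^ 2 - 4 * rho x).
  { pose proof (Hdq x Hx) as H; rewrite dqfun_eq in H; lra. }
  set (G := fun y => nfun y * nfun y - (2 * C * (qfun y + qfun y * qfun y) - qfun y * qfun y - 4 * rho y)).
  assert (HG0 : is_derive G x 0).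
  { apply (is_derive_ext_loc (fun _ => 0)); [| apply (is_derive_const 0 x)].
    apply (filter_imp (fun u => a < u /\ u < b)).
    - intros u Hu; pose proof (Hdq u Hu) as H; rewrite dqfun_eq in H; unfold G; simpl; lra.
    - apply filter_and; [apply (open_gt a) | apply (open_lt b)]; apply Hx. }
  assert (HG1 : is_derive G x
    (2 * nfun x * (qfun x * nfun x / x)
     - ((2 * C * (1 + 2 * qfun x) - 2 * qfun x) * (dqfun x / x)
        - 4 * (2 * x * (1 + x ^ 2) / (1 - x ^ 2) ^ 3)))).
  { assert (Dn := is_derive_nfun x ltac:(lra)).
    assert (Dq := is_derive_qfun x ltac:(lra)).
    assert (Dr := is_derive_rho x ltac:(lra)).
    unfold G; auto_derive.
    - repeat split; eexists; eassumption.
    - assert (En : Derive (fun x : R => nfun x) x = _) by (apply is_derive_unique, Dn).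
      assert (Eq : Derive (fun x : R => qfun x) x = _) by (apply is_derive_unique, Dq).
      assert (Er : Derive (fun x : R => rho x) x = _) by (apply is_derive_unique, Dr).
      rewrite En, Eq, Er; field; lra. }
  apply is_derive_unique in HG0; rewrite (is_derive_unique _ _ _ HG1), (Hdq x Hx) in HG0.
  replace (2 * nfun x * (qfun x * nfun x / x)) with (2 * qfun x * nfun x ^ 2 / x) in HG0
    by (field; lra).
  rewrite Hn in HG0; unfold rho in HG0; unfold Hconst_poly.
  assert (Hk3 : 0 < (1 - x ^ 2) ^ 3) by (apply pow_lt; lra).
  (* Since [1 - z = 1 / (1 + q)], the relation in [q] is this nonzero multiple of the polynomial in
     [z]. *)
  apply (Rmult_eq_reg_r (- (2 * (1 + qfun x) ^ 3 / (x * (1 - x ^ 2) ^ 3)))).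
  - rewrite Rmult_0_l, <- HG0; field; lra.
  - assert (0 < (1 + qfun x) ^ 3) by (apply pow_lt; lra).
    apply Rlt_not_eq, Ropp_lt_gt_0_contravar, Rdiv_lt_0_compat; [lra | nra].
Qed.

(** The first summand is negative and of degree 3 in [X = x^2], the last is positive and only of
    degree 2, and the middle one is at most 0. The thresholds do not depend on [C], as
    [C^2 - 3 C >= - 9 / 4]. *)
Lemma Hconst_poly_neg (C x z : R) : 4 <= x -> 10 <= z -> Hconst_poly C x z < 0.
Proof.
  intros Hx Hz; unfold Hconst_poly.
  assert (HX : 16 <= x ^ 2) by nra; set (X := x ^ 2) in *.
  assert (HC : - (9 / 4) <= C ^ 2 - 3 * C) by (pose proof (pow2_ge_0 (C - 3 / 2)); nra).
  assert (H1 : z ^ 3 / 2 <= z ^ 3 + (C ^ 2 - 3 * C) * z ^ 2 + C ^ 2 * z).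
  { assert (0 <= C ^ 2 * z) by (apply Rmult_le_pos; [apply pow2_ge_0 | lra]).
    assert (0 <= z ^ 2) by apply pow2_ge_0.
    assert (10 * z ^ 2 <= z ^ 3) by (simpl in *; nra).
    nra. }
  assert (H2 : 8 * X * (1 + X) < (X - 1) ^ 3).
  { replace ((X - 1) ^ 3) with ((X - 1) * (X - 1) ^ 2) by ring.
    apply Rlt_le_trans with (15 * (X - 1) ^ 2); [nra |].
    apply Rmult_le_compat_r; [apply pow2_ge_0 | lra]. }
  assert (H3 : (z - 1) ^ 3 <= z ^ 3) by (apply pow_incr; lra).
  assert (0 < z ^ 3) by (apply pow_lt; lra).
  assert (H4 : 0 <= X * (X - 1) * (z * (z - 1) ^ 2))
    by (repeat apply Rmult_le_pos; try apply pow2_ge_0; lra).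
  assert (H5 : (X - 1) ^ 3 * (z ^ 3 / 2) <= (X - 1) ^ 3 * (z ^ 3 + (C ^ 2 - 3 * C) * z ^ 2 + C ^ 2 * z))
    by (apply Rmult_le_compat_l; [apply pow_le; lra | assumption]).
  assert (H6 : 8 * X * (1 + X) * z ^ 3 < (X - 1) ^ 3 * z ^ 3) by (apply Rmult_lt_compat_r; assumption).
  assert (H7 : X * (1 + X) * (z - 1) ^ 3 <= X * (1 + X) * z ^ 3) by (apply Rmult_le_compat_l; nra).
  replace ((1 - X) ^ 3) with (- (X - 1) ^ 3) by ring.
  replace ((1 - z) ^ 3) with (- (z - 1) ^ 3) by ring.
  replace ((1 - z) ^ 2) with ((z - 1) ^ 2) by ring.
  lra.
Qed.

(* On an interval where [H = C] one has [q / (1 + q) = c * x ^ C], so that the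
   polynomial relation becomes an exponential sum in [ln x]; it then vanishes for all
   [x > 0], which is impossible for [x] large. *)
Lemma Hfun_not_const (C a b : R) :
  0 < C -> 0 < a < b -> b <= 1 -> ~ (forall x, a < x < b -> Hfun x = C).
Proof.
  intros HC Hab Hb HH.
  assert (HF : exists d, forall x, a < x < b -> qfun x / (1 + qfun x) = exp (d + C * ln x)).
  { set (F := fun x => ln (qfun x) - ln (1 + qfun x) - C * ln x).
    exists (F ((a + b) / 2)); intros x Hx.
    rewrite (eq_of_derive_zero F a b) with (y := x); [| | lra | exact Hx].
    - unfold F; pose proof (qfun_pos x ltac:(lra)).
      replace (_ + C * ln x) with (ln (qfun x) + - ln (1 + qfun x)) by ring.
      rewrite exp_plus, exp_Ropp, !exp_ln by lra; reflexivity.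
    - intros y Hy; pose proof (qfun_pos y ltac:(lra)) as Hq.
      assert (Dq := is_derive_qfun y ltac:(lra)).
      unfold F; auto_derive.
      + repeat split; try lra; eexists; eassumption.
      + assert (Eq : Derive (fun x : R => qfun x) y = _) by (apply is_derive_unique, Dq).
        rewrite Eq.
        replace (dqfun y) with (C * (qfun y * (1 + qfun y)))
          by (rewrite <- (HH y Hy); unfold Hfun; field; lra).
        field; lra. }
  destruct HF as [d Hd].
  assert (Hz : forall s, Hconst_poly C (exp (0 + 1 * s)) (exp (d + C * s)) = 0).
  { apply (is_expsum_zero (fun s => Hconst_poly C (exp (0 + 1 * s)) (exp (d + C * s))) (ln a) (ln b)).
    - unfold Hconst_poly;
      repeat first [apply is_expsum_exp | apply is_expsum_minus | apply is_expsum_plus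
        | apply is_expsum_mult | apply is_expsum_pow | apply is_expsum_const].
    - apply ln_increasing; lra.
    - intros s Hs.
      assert (Hx : a < exp s < b).
      { rewrite <- (exp_ln a), <- (exp_ln b) by lra; split; apply exp_increasing; lra. }
      rewrite Rmult_1_l, Rplus_0_l.
      rewrite <- (ln_exp s) at 2; rewrite <- Hd by exact Hx.
      apply (Hfun_const_poly C a b); auto; lra. }
  (* By [1 + u <= exp u], exponents of at least 3 and 9 reach the thresholds 4 and 10 of
     [Hconst_poly_neg]. *)
  set (s := Rmax 3 ((9 - d) / C)).
  assert (Hs : 3 <= s /\ 9 <= d + C * s).
  { split; [apply Rmax_l |].
    pose proof (Rmax_r 3 ((9 - d) / C)) as H; fold s in H.
    apply Rle_div_l in H; lra. }
  pose proof (Hconst_poly_neg C (exp (0 + 1 * s)) (exp (d + C * s))) as Hneg.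
  rewrite Hz in Hneg; apply (Rlt_irrefl 0), Hneg.
  - pose proof (exp_ineq1_le (0 + 1 * s)); lra.
  - pose proof (exp_ineq1_le (d + C * s)); lra.
Qed.

(** * Power means as quasi-arithmetic means *)

(** Dividing by [lambda] makes this generator increasing for negative [lambda] too, and gives it the
    derivative [u^(lambda - 1)] in all cases, 0 included. *)
Definition phi (lambda u : R) : R :=
  if Req_EM_T lambda 0 then ln u else Rpower u lambda / lambda.

Lemma is_derive_phi (lambda u : R) :
  0 < u -> is_derive (phi lambda) u (Rpower u lambda / u).
Proof.
  intros Hu; unfold phi, Rpower; destruct (Req_EM_T lambda 0) as [-> | Hl].
  - rewrite Rmult_0_l, exp_0; auto_derive; [assumption | reflexivity].
  - auto_derive; [assumption |]; field; lra.
Qed.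

Lemma phi_lt (lambda u v : R) : 0 < u -> 0 < v -> phi lambda u < phi lambda v <-> u < v.
Proof.
  assert (H : forall u v, 0 < u -> u < v -> phi lambda u < phi lambda v).
  { intros x y Hx Hxy.
    apply (pos_derive_incr (phi lambda) (fun u => Rpower u lambda / u)); [lra | |].
    - intros c Hc; apply is_derive_phi; lra.
    - intros c Hc; apply Rdiv_lt_0_compat; [apply exp_pos | lra]. }
  intros Hu Hv; split; [| now apply H].
  intros Hlt; destruct (Rtotal_order u v) as [| [<- | Hvu]]; [assumption | lra |].
  specialize (H v u Hv Hvu); lra.
Qed.

Lemma power_mean_pos (lambda x y : R) : 0 < x -> 0 < y -> 0 < power_mean lambda x y.
Proof.
  intros Hx Hy; unfold power_mean; destruct (Req_EM_T lambda 0).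
  - apply sqrt_lt_R0; now apply Rmult_lt_0_compat.
  - apply exp_pos.
Qed.

Lemma phi_power_mean (lambda x y : R) :
  0 < x -> 0 < y -> phi lambda (power_mean lambda x y) = (phi lambda x + phi lambda y) / 2.
Proof.
  intros Hx Hy; unfold power_mean, phi; destruct (Req_EM_T lambda 0) as [_ | Hl].
  - rewrite <- Rpower_sqrt by (now apply Rmult_lt_0_compat).
    unfold Rpower; rewrite ln_exp, ln_mult by assumption; field.
  - rewrite Rpower_mult.
    replace (1 / lambda * lambda) with 1 by (field; assumption).
    rewrite Rpower_1; [field; assumption |].
    pose proof (exp_pos (lambda * ln x)); pose proof (exp_pos (lambda * ln y)).
    unfold Rpower; lra.
Qed.

Lemma power_mean_comm (lambda x y : R) : power_mean lambda x y = power_mean lambda y x.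
Proof.
  unfold power_mean; destruct (Req_EM_T lambda 0); [now rewrite Rmult_comm |].
  now rewrite (Rplus_comm (Rpower x lambda)).
Qed.

Lemma phi_inj (lambda u v : R) : 0 < u -> 0 < v -> phi lambda u = phi lambda v -> u = v.
Proof.
  intros Hu Hv H; destruct (Rtotal_order u v) as [Huv | [| Huv]]; [| assumption |];
    apply (phi_lt lambda) in Huv; lra.
Qed.

Lemma power_mean_diag (lambda x : R) : 0 < x -> power_mean lambda x x = x.
Proof.
  intros Hx; apply (phi_inj lambda); [now apply power_mean_pos | assumption |].
  rewrite phi_power_mean by assumption; field.
Qed.

(** * The mean inequality from the monotonicity of [Lfun] *)

Definition Lfun (lambda x : R) : R := lambda * (ln (m x) - ln x) + ln (qfun x).

(** Combine [t ln (m / x) = - (1 + q)] with [t ln q = (1 + q) H]. *)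
Lemma is_derive_Lfun (lambda x : R) :
  0 < x < 1 -> is_derive (Lfun lambda) x ((1 + qfun x) * (Hfun x - lambda) / x).
Proof.
  intros Hx; pose proof (m_pos x Hx); pose proof (qfun_pos x Hx).
  assert (Dm := is_derive_m x Hx); assert (Dq := is_derive_qfun x Hx).
  unfold Lfun; auto_derive.
  - repeat split; try lra; eexists; eassumption.
  - assert (Em : Derive (fun x : R => m x) x = _) by (apply is_derive_unique, Dm).
    assert (Eq : Derive (fun x : R => qfun x) x = _) by (apply is_derive_unique, Dq).
    rewrite Em, Eq; unfold Hfun; field; lra.
Qed.

(* Cauchy's mean value theorem for [phi lambda o m] and [phi lambda], whose
   derivatives have quotient [- exp (Lfun lambda)]. *)
Lemma phi_m_increment (lambda x y : R) :
  0 < x -> x < y -> y < 1 ->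
  exists c, x < c < y /\
    phi lambda (m y) - phi lambda (m x) = - exp (Lfun lambda c) * (phi lambda y - phi lambda x).
Proof.
  intros Hx Hxy Hy.
  set (dU := fun t => - qfun t * m t / t * (Rpower (m t) lambda / m t)).
  set (dV := fun t => Rpower t lambda / t).
  set (A := phi lambda y - phi lambda x); set (B := phi lambda (m y) - phi lambda (m x)).
  (* The auxiliary function takes equal values at [x] and [y]. *)
  destruct (MVT_cor2 (fun t => A * phi lambda (m t) - B * phi lambda t)
    (fun t => A * dU t - B * dV t) x y Hxy) as (c & Hc & Hcxy).
  - intros c Hc; apply is_derive_Reals.
    apply (is_derive_minus (fun t => A * phi lambda (m t)) (fun t => B * phi lambda t)).
    + apply (is_derive_scal (fun t => phi lambda (m t)) c A).
      apply (is_derive_comp (phi lambda) m).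
      * apply is_derive_phi, m_pos; lra.
      * apply is_derive_m; lra.
    + apply (is_derive_scal (phi lambda) c B), is_derive_phi; lra.
  - exists c; split; [assumption |].
    pose proof (m_pos c ltac:(lra)) as Hm; pose proof (qfun_pos c ltac:(lra)) as Hq.
    assert (Hz : A * dU c - B * dV c = 0).
    { apply (Rmult_eq_reg_r (y - x)); [| lra]; rewrite <- Hc; unfold A, B; ring. }
    assert (HU : dU c = - exp (Lfun lambda c) * dV c).
    { unfold dU, dV, Lfun, Rpower.
      replace (lambda * (ln (m c) - ln c)) with (lambda * ln (m c) + - (lambda * ln c)) by ring.
      rewrite !exp_plus, exp_Ropp, exp_ln by assumption.
      pose proof (exp_pos (lambda * ln c)); field; lra. }
    assert (HV : 0 < dV c) by (apply Rdiv_lt_0_compat; [apply exp_pos | lra]).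
    apply (Rmult_eq_reg_r (dV c)); [| lra].
    rewrite HU in Hz; fold A B; lra.
Qed.

Lemma power_mean_between (lambda x y : R) :
  0 < x -> x < y -> x < power_mean lambda x y < y.
Proof.
  intros Hx Hxy.
  pose proof (power_mean_pos lambda x y ltac:(lra) ltac:(lra)).
  pose proof (phi_power_mean lambda x y ltac:(lra) ltac:(lra)).
  assert (phi lambda x < phi lambda y) by (apply phi_lt; lra).
  split; apply (phi_lt lambda); lra.
Qed.

(** The mean [z] of [x] and [y] splits [[x, y]] into two parts on which [phi lambda] has equal
    increments. Applying [phi_m_increment] to each part leaves a comparison of [Lfun] at one point
    of each. *)
Lemma power_mean_gap (lambda x y : R) :
  0 < x -> x < y -> y < 1 ->
  exists c d delta, x < c /\ c < d /\ d < y /\ 0 < delta /\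
    phi lambda (m (power_mean lambda x y)) - phi lambda (power_mean lambda (m x) (m y))
    = delta * (exp (Lfun lambda d) - exp (Lfun lambda c)).
Proof.
  intros Hx Hxy Hy.
  pose proof (power_mean_between lambda x y Hx Hxy) as Hb.
  pose proof (phi_power_mean lambda x y ltac:(lra) ltac:(lra)) as Hz.
  rewrite (phi_power_mean lambda (m x) (m y)) by (apply m_pos; lra).
  set (z := power_mean lambda x y) in *.
  assert (Hphi : phi lambda x < phi lambda y) by (apply phi_lt; lra).
  destruct (phi_m_increment lambda x z) as (c & Hc & Hcz); try lra.
  destruct (phi_m_increment lambda z y) as (d & Hd & Hdz); try lra.
  (* This [delta] is half the common increment of [phi lambda] on the two parts. *)
  exists c, d, ((phi lambda y - phi lambda x) / 4); repeat split; try lra.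
  rewrite Hz in Hcz, Hdz; lra.
Qed.

Lemma power_mean_m_lt (lambda x y : R) :
  0 < x -> x < y -> y < 1 ->
  (forall s t, x < s -> s < t -> t < y -> Lfun lambda s < Lfun lambda t) ->
  power_mean lambda (m x) (m y) < m (power_mean lambda x y).
Proof.
  intros Hx Hxy Hy HL.
  destruct (power_mean_gap lambda x y Hx Hxy Hy) as (c & d & delta & Hc & Hcd & Hd & Hdelta & H).
  pose proof (power_mean_between lambda x y Hx Hxy).
  specialize (HL c d Hc Hcd Hd); apply exp_increasing in HL.
  apply (phi_lt lambda); [apply power_mean_pos; apply m_pos; lra | apply m_pos; lra | nra].
Qed.

Lemma power_mean_m_gt (lambda x y : R) :
  0 < x -> x < y -> y < 1 ->
  (forall s t, x < s -> s < t -> t < y -> Lfun lambda t < Lfun lambda s) ->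
  m (power_mean lambda x y) < power_mean lambda (m x) (m y).
Proof.
  intros Hx Hxy Hy HL.
  destruct (power_mean_gap lambda x y Hx Hxy Hy) as (c & d & delta & Hc & Hcd & Hd & Hdelta & H).
  pose proof (power_mean_between lambda x y Hx Hxy).
  specialize (HL c d Hc Hcd Hd); apply exp_increasing in HL.
  apply (phi_lt lambda); [apply m_pos; lra | apply power_mean_pos; apply m_pos; lra | nra].
Qed.

Lemma Lfun_incr (lambda a b : R) :
  0 < a -> a < b -> b < 1 -> (forall r, a < r < b -> lambda < Hfun r) ->
  Lfun lambda a < Lfun lambda b.
Proof.
  intros Ha Hab Hb HH.
  apply (pos_derive_incr (Lfun lambda) (fun x => (1 + qfun x) * (Hfun x - lambda) / x)); [lra | |].
  - intros c Hc; apply is_derive_Lfun; lra.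
  - intros c Hc; specialize (HH c Hc); pose proof (qfun_pos c ltac:(lra)).
    apply Rdiv_lt_0_compat; [apply Rmult_lt_0_compat |]; lra.
Qed.

Lemma Lfun_nonincr (lambda a b : R) :
  0 < a -> a <= b -> b < 1 -> (forall r, a < r < b -> Hfun r <= lambda) ->
  Lfun lambda b <= Lfun lambda a.
Proof.
  intros Ha [Hab | <-] Hb HH; [| lra].
  destruct (MVT_cor2 (Lfun lambda) (fun x => (1 + qfun x) * (Hfun x - lambda) / x) a b Hab)
    as (c & Hc & Hcab).
  - intros c Hc; apply is_derive_Reals, is_derive_Lfun; lra.
  - specialize (HH c Hcab); pose proof (qfun_pos c ltac:(lra)).
    assert (0 <= (1 + qfun c) * (lambda - Hfun c) / c * (b - a)).
    { apply Rmult_le_pos; [| lra]; apply Rdiv_le_0_compat; [apply Rmult_le_pos |]; lra. }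
    replace ((1 + qfun c) * (Hfun c - lambda) / c)
      with (- ((1 + qfun c) * (lambda - Hfun c) / c)) in Hc by (field; lra).
    lra.
Qed.

(** The weak bound on [Hfun] gives weak monotonicity. Equal values at [a] and [b] would make [Lfun]
    constant in between, hence [Hfun = lambda] there, against [Hfun_not_const]. This yields
    strictness even when [lambda] is the supremum. *)
Lemma Lfun_decr (lambda a b : R) :
  0 < lambda -> 0 < a -> a < b -> b < 1 -> (forall r, a < r < b -> Hfun r <= lambda) ->
  Lfun lambda b < Lfun lambda a.
Proof.
  intros Hl Ha Hab Hb HH; apply Rnot_le_lt; intros Hle.
  apply (Hfun_not_const lambda a b Hl ltac:(lra) ltac:(lra)).
  intros x Hx.
  assert (Hconst : forall y, a < y < b -> Lfun lambda y = Lfun lambda a).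
  { intros y Hy; apply Rle_antisym.
    - apply Lfun_nonincr; try lra; intros r Hr; apply HH; lra.
    - apply Rle_trans with (1 := Hle).
      apply Lfun_nonincr; try lra; intros r Hr; apply HH; lra. }
  assert (H0 : is_derive (Lfun lambda) x 0).
  { apply (is_derive_ext_loc (fun _ => Lfun lambda a)); [| apply (is_derive_const (Lfun lambda a) x)].
    apply (filter_imp (fun u => a < u /\ u < b)).
    - intros u Hu; symmetry; now apply Hconst.
    - apply filter_and; [apply (open_gt a) | apply (open_lt b)]; apply Hx. }
  apply is_derive_unique in H0.
  rewrite (is_derive_unique _ _ _ (is_derive_Lfun lambda x ltac:(lra))) in H0.
  pose proof (qfun_pos x ltac:(lra)).
  apply (Rmult_eq_reg_l ((1 + qfun x) / x)); [| apply Rgt_not_eq, Rdiv_lt_0_compat; lra].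
  apply Rminus_diag_uniq; rewrite <- H0; field; lra.
Qed.

(** * Sharpness: one value of [H] decides the inequality locally *)

Lemma locally_right_interval (P : R -> Prop) (r : R) :
  0 < r < 1 -> locally r P -> exists y, r < y < 1 /\ forall s, r < s < y -> P s.
Proof.
  intros Hr [eps He]; pose proof (cond_pos eps).
  exists (r + Rmin eps (1 - r) / 2).
  assert (0 < Rmin eps (1 - r) <= 1 - r /\ Rmin eps (1 - r) <= eps).
  { unfold Rmin; destruct (Rle_dec _ _); lra. }
  split; [lra |].
  intros s Hs; apply He.
  change (Rabs (s - r) < eps); rewrite Rabs_pos_eq; lra.
Qed.

(** Continuity carries the bound at [r] over to an interval starting at [r], where [Lfun] decreases;
    the endpoints of that interval are the pair. *)
Lemma Hfun_lt_witness (lambda r : R) :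
  0 < r < 1 -> 0 < lambda -> Hfun r < lambda ->
  exists x y, 0 < x < 1 /\ 0 < y < 1 /\
    m (power_mean lambda x y) < power_mean lambda (m x) (m y).
Proof.
  intros Hr Hl HH.
  destruct (locally_right_interval (fun s => Hfun s < lambda) r Hr) as (y & Hy & Hs).
  - apply (continuous_Hfun r Hr (fun h => h < lambda)), (open_lt lambda); assumption.
  - exists r, y; repeat split; try lra.
    apply power_mean_m_gt; try lra.
    intros s t Hrs Hst Hty; apply Lfun_decr; try lra.
    intros u Hu; apply Rlt_le, Hs; lra.
Qed.

Lemma Hfun_gt_witness (lambda r : R) :
  0 < r < 1 -> lambda < Hfun r ->
  exists x y, 0 < x < 1 /\ 0 < y < 1 /\
    power_mean lambda (m x) (m y) < m (power_mean lambda x y).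
Proof.
  intros Hr HH.
  destruct (locally_right_interval (fun s => lambda < Hfun s) r Hr) as (y & Hy & Hs).
  - apply (continuous_Hfun r Hr (fun h => lambda < h)), (open_gt lambda); assumption.
  - exists r, y; repeat split; try lra.
    apply power_mean_m_lt; try lra.
    intros s t Hrs Hst Hty; apply Lfun_incr; try lra.
    intros u Hu; apply Hs; lra.
Qed.

(** * The infimum of [H], approached at 0 *)

(** From [2 w <= q] and [n <= q] follows [t q <= (w + n + 2 rho / n) q], and [1 + q >= 1]. Each of
    the three terms tends to 0 with [r]. *)
Lemma Hfun_le_sum (r : R) :
  0 < r < 1 -> Hfun r <= wfun r + nfun r + 2 * rho r / nfun r.
Proof.
  intros Hr; pose proof (qfun_pos r Hr); pose proof (nfun_pos r Hr).
  pose proof (wfun_bounds r Hr); pose proof (rho_pos r Hr).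
  assert (Hx : 0 < 2 * rho r / nfun r) by (apply Rdiv_lt_0_compat; lra).
  apply Rle_div_l; [nra |].
  set (x := 2 * rho r / nfun r) in *.
  assert (Hxn : 2 * rho r = x * nfun r) by (unfold x; field; lra).
  apply Rle_trans with ((wfun r + nfun r + x) * qfun r); [| nra].
  unfold dqfun, qfun; nra.
Qed.

(** As [- t m = q m = 2 w m + kappa], [m] grows at least like [kappa ln (1 / r)] towards 0, so that
    [n] tends to 0. *)
Lemma m_lower (r : R) : 0 < r < 1 / 2 -> kappa * (ln (1 / 2) - ln r) < m r.
Proof.
  intros Hr.
  assert (- m r - kappa * ln r < - m (1 / 2) - kappa * ln (1 / 2)).
  { apply (pos_derive_incr (fun r => - m r - kappa * ln r) (fun r => 2 * wfun r * m r / r)); [lra | |].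
    - intros c Hc; pose proof (m_pos c ltac:(lra)).
      replace (2 * wfun c * m c / c) with (- (- qfun c * m c / c) - kappa * / c)
        by (unfold qfun, nfun; field; lra).
      apply (is_derive_minus (fun r => - m r) (fun r => kappa * ln r)).
      + apply (is_derive_opp m), is_derive_m; lra.
      + apply (is_derive_scal ln c kappa); auto_derive; [lra | field; lra].
    - intros c Hc; pose proof (m_pos c ltac:(lra)); pose proof (wfun_bounds c ltac:(lra)).
      apply Rdiv_lt_0_compat; [apply Rmult_lt_0_compat |]; lra. }
  pose proof (m_pos (1 / 2) ltac:(lra)); lra.
Qed.

Lemma Hfun_small (lambda : R) : 0 < lambda -> exists r, 0 < r < 1 /\ Hfun r < lambda.
Proof.
  intros Hl; pose proof kappa_pos as Hkap; pose proof PI_RGT_0.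
  (* Each term of [Hfun_le_sum] is to be below [lambda / 3]: [r <= a] serves [n], [r <= lambda / 4]
     serves [w], and [r <= b] serves [2 rho / n]. The 7 works since [1 / 7 < 1 / 3 * 9 / 16], where
     [9 / 16] bounds [(1 - r^2)^2] from below for [r < 1 / 2]. *)
  set (a := exp (- (3 / lambda)) * (1 / 2)); set (b := kappa * lambda / (7 * PI)).
  assert (Ha : 0 < a < 1 / 2).
  { pose proof (exp_pos (- (3 / lambda))).
    assert (exp (- (3 / lambda)) < exp 0).
    { apply exp_increasing, Ropp_lt_gt_0_contravar, Rdiv_lt_0_compat; lra. }
    rewrite exp_0 in *; unfold a; lra. }
  assert (Hb : 0 < b) by (apply Rdiv_lt_0_compat; [now apply Rmult_lt_0_compat | lra]).
  set (r := Rmin (Rmin a (lambda / 4)) b).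
  assert (Hr : 0 < r /\ r <= a /\ r <= lambda / 4 /\ r <= b)
    by (unfold r, Rmin; repeat destruct (Rle_dec _ _); lra).
  clearbody r; exists r; split; [lra |].
  apply Rle_lt_trans with (1 := Hfun_le_sum r ltac:(lra)).
  pose proof (wfun_bounds r ltac:(lra)) as Hw.
  pose proof (m_pos r ltac:(lra)) as Hm.
  assert (Hw' : r ^ 2 / (1 - r ^ 2) <= r) by (apply Rle_div_l; nra).
  assert (Hn : nfun r < lambda / 3).
  { assert (Hln : ln r <= - (3 / lambda) + ln (1 / 2)).
    { rewrite <- (ln_exp (- (3 / lambda))), <- ln_mult by (try apply exp_pos; lra).
      apply ln_le; [lra | apply Hr]. }
    apply Rlt_div_l; [assumption |].
    apply Rle_lt_trans with (lambda / 3 * (kappa * (3 / lambda))); [right; field; lra |].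
    apply Rmult_lt_compat_l; [lra |].
    apply Rle_lt_trans with (2 := m_lower r ltac:(lra)).
    apply Rmult_le_compat_l; lra. }
  assert (Hrho : 2 * rho r / nfun r < lambda / 3).
  { replace (2 * rho r / nfun r) with (2 * r * (r * m r) / (kappa * (1 - r ^ 2) ^ 2))
      by (unfold rho, nfun; field; nra).
    apply Rlt_div_l; [apply Rmult_lt_0_compat; [assumption | apply pow_lt; nra] |].
    assert (H9 : 9 / 16 <= (1 - r ^ 2) ^ 2).
    { replace (9 / 16) with ((3 / 4) ^ 2) by lra; apply pow_incr; nra. }
    pose proof (m_le r ltac:(lra)) as Hmr.
    apply Rle_lt_trans with (2 * b * (PI / 2)).
    - apply Rmult_le_compat; [lra | apply Rmult_le_pos; lra | lra | assumption].
    - replace (2 * b * (PI / 2)) with (kappa * lambda / 7) by (unfold b; field; lra).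
      assert (0 < kappa * lambda) by (now apply Rmult_lt_0_compat). nra. }
  lra.
Qed.

(** * The inequalities on the whole square and their equality cases *)

(** Both means are symmetric, and on the diagonal both sides equal [m x]; the relation [P] is left
    open to cover both directions. *)
Lemma strict_off_diagonal (lambda : R) (P : R -> R -> Prop) :
  (forall x y, 0 < x -> x < y -> y < 1 ->
     P (power_mean lambda (m x) (m y)) (m (power_mean lambda x y))) ->
  forall x y, 0 < x < 1 -> 0 < y < 1 ->
    x = y /\ power_mean lambda (m x) (m y) = m (power_mean lambda x y) \/
    x <> y /\ P (power_mean lambda (m x) (m y)) (m (power_mean lambda x y)).
Proof.
  intros Hlt x y Hx Hy.
  destruct (Rtotal_order x y) as [Hxy | [-> | Hxy]].
  - right; split; [lra |]; apply Hlt; lra.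
  - left; split; [reflexivity |].
    now rewrite !power_mean_diag by (try apply m_pos; lra).
  - right; split; [lra |].
    rewrite (power_mean_comm lambda x), (power_mean_comm lambda (m x)); apply Hlt; lra.
Qed.

Lemma power_mean_m_nonpos (lambda : R) :
  lambda <= 0 -> forall x y, 0 < x < 1 -> 0 < y < 1 ->
    x = y /\ power_mean lambda (m x) (m y) = m (power_mean lambda x y) \/
    x <> y /\ power_mean lambda (m x) (m y) < m (power_mean lambda x y).
Proof.
  intros Hl; apply (strict_off_diagonal lambda Rlt).
  intros x y Hx Hxy Hy; apply power_mean_m_lt; try lra.
  intros s t Hs Hst Ht; apply Lfun_incr; try lra.
  intros r Hr; pose proof (Hfun_pos r ltac:(lra)); lra.
Qed.

Lemma power_mean_m_large (lambda : R) :
  0 < lambda -> (forall r, 0 < r < 1 -> Hfun r <= lambda) ->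
  forall x y, 0 < x < 1 -> 0 < y < 1 ->
    x = y /\ power_mean lambda (m x) (m y) = m (power_mean lambda x y) \/
    x <> y /\ power_mean lambda (m x) (m y) > m (power_mean lambda x y).
Proof.
  intros Hl HH; apply (strict_off_diagonal lambda Rgt).
  intros x y Hx Hxy Hy; apply power_mean_m_gt; try lra.
  intros s t Hs Hst Ht; apply Lfun_decr; try lra.
  intros r Hr; apply HH; lra.
Qed.

Theorem theorem1p3 :
  (forall lambda : R,
     (forall x y : R, 0 < x < 1 -> 0 < y < 1 ->
        power_mean lambda (m x) (m y) <= m (power_mean lambda x y))
     <-> lambda <= 0)
  /\
  (forall lambda : R, lambda <= 0 ->
     forall x y : R, 0 < x < 1 -> 0 < y < 1 ->
       (power_mean lambda (m x) (m y) = m (power_mean lambda x y) <-> x = y))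
  /\
  (exists C : R,
     0 < C /\
     (forall lambda : R,
        (forall x y : R, 0 < x < 1 -> 0 < y < 1 ->
           power_mean lambda (m x) (m y) >= m (power_mean lambda x y))
        <-> lambda >= C) /\
     (forall lambda : R, lambda >= C ->
        forall x y : R, 0 < x < 1 -> 0 < y < 1 ->
          (power_mean lambda (m x) (m y) = m (power_mean lambda x y)
           <-> x = y))).
Proof.
  split; [| split].
  - intros lambda; split.
    + intros H; apply Rnot_lt_le; intros Hl.
      (* [H] takes values below every positive [lambda], so the inequality fails strictly at some
         pair. *)
      destruct (Hfun_small lambda Hl) as (r & Hr & HH).
      destruct (Hfun_lt_witness lambda r Hr Hl HH) as (x & y & Hx & Hy & Hxy).
      specialize (H x y Hx Hy); lra.
    + intros Hl x y Hx Hy.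
      destruct (power_mean_m_nonpos lambda Hl x y Hx Hy); lra.
  - intros lambda Hl x y Hx Hy.
    destruct (power_mean_m_nonpos lambda Hl x y Hx Hy) as [[? ?] | [? ?]]; split; intros; lra.
  - destruct (completeness (fun h => exists r, 0 < r < 1 /\ h = Hfun r)) as [C [HC HCmin]].
    + exists 3; intros h (r & Hr & ->); now apply Hfun_le.
    + exists (Hfun (1 / 2)), (1 / 2); split; [lra | reflexivity].
    + assert (HCle : forall r, 0 < r < 1 -> Hfun r <= C)
        by (intros r Hr; apply HC; exists r; auto).
      assert (HC0 : 0 < C).
      { apply Rlt_le_trans with (Hfun (1 / 2)); [apply Hfun_pos | apply HCle]; lra. }
      assert (Hlarge : forall lambda, lambda >= C -> forall r, 0 < r < 1 -> Hfun r <= lambda).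
      { intros lambda Hl r Hr; specialize (HCle r Hr); lra. }
      exists C; split; [assumption | split].
      * intros lambda; split.
        (* The reverse inequality forces [lambda] to be an upper bound of [H], hence at least the
           least one. *)
        -- intros H; apply Rle_ge, HCmin; intros h (r & Hr & ->).
           apply Rnot_lt_le; intros HH.
           destruct (Hfun_gt_witness lambda r Hr HH) as (x & y & Hx & Hy & Hxy).
           specialize (H x y Hx Hy); lra.
        -- intros Hl x y Hx Hy.
           destruct (power_mean_m_large lambda ltac:(lra) (Hlarge lambda Hl) x y Hx Hy); lra.
      * intros lambda Hl x y Hx Hy.
        destruct (power_mean_m_large lambda ltac:(lra) (Hlarge lambda Hl) x y Hx Hy)
          as [[? ?] | [? ?]]; split; intros; lra.
Qed.
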